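(* Let $f:X\to X$ be a continuous map of a compact metric space $(X,d)$, and let $\mu$ be an $f$-invariant ergodic Borel probability measure on $X$ with positive metric entropy $h_\mu(f)>0$. Then $\mu$ is an expansive measure of $f$, i.e., there exists $\delta>0$ such that $\mu(\Phi_\delta(x))=0$ for every $x\in X$, where $\Phi_\delta(x)=\{y\in X: d(f^i(y),f^i(x))\le\delta \text{ for all } i\in\mathbb{N}\}$.
   Context: Here $\mathbb{N}=\{0,1,2,\dots\}$. $\Phi_\delta(x)$ is called the dynamical ball of radius $\delta$ around $x$. A Borel probability measure $\mu$ (not necessarily invariant) is called an expansive measure of a measurable map $f$ if there is $\delta>0$ with $\mu(\Phi_\delta(x))=0$ for all $x\in X$. *)

(* Defs.v *)
From HB Require Import structures.
From mathcomp Require Import all_boot all_order all_algebra.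
From mathcomp Require Import all_classical all_reals all_analysis.

Set Implicit Arguments.
Unset Strict Implicit.
Unset Printing Implicit Defensive.

Import Order.TTheory GRing.Theory Num.Theory.
Local Open Scope classical_set_scope.
Local Open Scope ring_scope.

(* A (nonempty) metric space.  Nonemptiness is harmless: a space carrying
   a probability measure is nonempty. *)
#[short(type="pointedMetricType")]
HB.structure Definition PointedMetric (K : numDomainType) :=
  { M of Metric K M & isPointed M }.

Definition borel_of {R : realType} (X : pointedMetricType R) :=
  g_sigma_algebraType (@open X).

Section ergodic_defs.
Context {R : realType} {X : pointedMetricType R}.
Local Notation BX := (borel_of X).

Definition invariant_measure (f : X -> X) (mu : probability BX R) : Prop :=
  forall A : set BX, measurable A -> mu (f @^-1` A) = mu A.

Definition ergodic_measure (f : X -> X) (mu : probability BX R) : Prop :=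
  forall A : set BX, measurable A -> f @^-1` A = A ->
    mu A = 0%E \/ mu A = 1%E.

Definition measurable_partition (k : nat) (P : 'I_k -> set BX) : Prop :=
  [/\ forall i, measurable (P i),
      forall i j, i != j -> P i `&` P j = set0 &
      \bigcup_(i in [set: 'I_k]) P i = [set: BX]].

Definition ent_fun (t : R) : R := if t == 0 then 0 else - (t * ln t).

(* cells of the join P v f^-1 P v ... v f^-(n-1) P, indexed by words
   w : 'I_n -> 'I_k *)
Definition join_cell (f : X -> X) (k n : nat) (P : 'I_k -> set BX)
  (w : {ffun 'I_n -> 'I_k}) : set BX :=
  [set x | forall i : 'I_n, P (w i) (iter i f x)].

Definition join_entropy (f : X -> X) (mu : probability BX R) (k n : nat)
  (P : 'I_k -> set BX) : R :=
  \sum_(w : {ffun 'I_n -> 'I_k}) ent_fun (fine (mu (join_cell f P w))).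

Definition partition_entropy (f : X -> X) (mu : probability BX R) (k : nat)
  (P : 'I_k -> set BX) : R :=
  limn (fun n : nat => (join_entropy f mu n P / n%:R : R^o)).

Definition metric_entropy (f : X -> X) (mu : probability BX R) : \bar R :=
  ereal_sup [set e : \bar R | exists (k : nat) (P : 'I_k -> set BX),
              measurable_partition P /\ e = (partition_entropy f mu P)%:E].

Definition dyn_ball (f : X -> X) (delta : R) (x : X) : set BX :=
  [set y | forall i : nat, mdist (iter i f y) (iter i f x) <= delta].

Definition expansive_measure (f : X -> X) (mu : probability BX R) : Prop :=
  exists2 delta : R, 0 < delta & forall x : X, mu (dyn_ball f delta x) = 0%E.

End ergodic_defs.

(* Main.v *)
(* If mu is not expansive then for every r some dynamical ball of radius r,
   around x say, has positive measure.  The union S of the balls around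
   x, f x, f^2 x, ... satisfies S <= f^-1 S, so by ergodicity it has measure 1:
   up to a set of small measure, every orbit is r-shadowed by one of finitely
   many points of the orbit of x.  By Lusin's theorem the symbol of a finite
   partition is, off a set of small measure, constant at scale r.  Hence the
   itinerary of a point is determined by boundedly many choices of a shadowing
   orbit plus, at each time, a variable that is trivial with probability close
   to 1, and the entropy of every partition vanishes. *)
Require Import Defs.
From HB Require Import structures.
From mathcomp Require Import all_boot all_order all_algebra.
From mathcomp Require Import ring lra.
From mathcomp Require Import all_classical all_reals all_analysis.
Import Order.TTheory GRing.Theory Num.Theory.
Local Open Scope classical_set_scope.
Local Open Scope ring_scope.

Set Implicit Arguments.
Unset Strict Implicit.
Unset Printing Implicit Defensive.

Lemma big_option (V : nmodType) (I : finType) (F : option I -> V) :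
  \sum_o F o = F None + \sum_i F (Some i).
Proof.
rewrite (bigD1 None)//=; congr (_ + _).
rewrite (reindex_omap Some id) => [|[]//].
by apply: eq_bigl => i /=; rewrite eqxx.
Qed.

(** * Inequalities for the function [- (t * ln t)] *)

Section ent_fun_theory.
Context {R : realType}.
Implicit Types p q r t : R.

Lemma ln_le_subr1 {t} : 0 < t -> ln t <= t - 1.
Proof.
move=> t0; have := @le_ln1Dx R (t - 1); rewrite addrCA subrr addr0; apply; lra.
Qed.

Lemma ent_funE t : ent_fun t = - (t * ln t).
Proof. by rewrite /ent_fun; case: eqP => // ->; rewrite mul0r oppr0. Qed.

Lemma ent_fun0 : ent_fun (0 : R) = 0.
Proof. by rewrite ent_funE mul0r oppr0. Qed.

Lemma ent_fun1 : ent_fun (1 : R) = 0.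
Proof. by rewrite ent_funE ln1 mulr0 oppr0. Qed.

Lemma ent_fun_le_1B t : 0 <= t -> ent_fun t <= 1 - t.
Proof.
rewrite le0r => /orP[/eqP->|t0]; first by rewrite ent_fun0; lra.
rewrite ent_funE -mulrN -lnV ?posrE//.
apply: (@le_trans _ _ (t * (t^-1 - 1))).
  by rewrite ler_pM2l//; apply: ln_le_subr1; rewrite invr_gt0.
by rewrite mulrBr divff ?gt_eqF// mulr1.
Qed.

(** With [t = s ^+ 2] one has [ent_fun t = 2 * s * ent_fun s], and [ent_fun s <= 1 - s <= 1]. *)
Lemma ent_fun_le_sqrt t : 0 <= t -> ent_fun t <= 2 * Num.sqrt t.
Proof.
rewrite le0r => /orP[/eqP->|t0].
  by rewrite ent_fun0 mulr_ge0// sqrtr_ge0.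
set s := Num.sqrt t; have s0 : 0 < s by rewrite sqrtr_gt0.
have -> : t = s ^+ 2 by rewrite sqr_sqrtr// ltW.
have := ent_fun_le_1B (ltW s0); rewrite !ent_funE lnXn//.
move=> h; have : s * (- (s * ln s)) <= s * (1 - s) by rewrite ler_pM2l.
by nra.
Qed.

(** Monotonicity of [ln]: both [ln p] and [ln q] are at most [ln (p + q)]. *)
Lemma ent_funD p q : 0 <= p -> 0 <= q ->
  ent_fun (p + q) <= ent_fun p + ent_fun q.
Proof.
rewrite le0r => /orP[/eqP->|p0]; first by rewrite ent_fun0 !add0r.
rewrite le0r => /orP[/eqP->|q0]; first by rewrite ent_fun0 !addr0.
rewrite !ent_funE mulrDl opprD lerD// lerN2 ler_pM2l// ler_ln ?posrE//; lra.
Qed.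

Lemma ent_fun_sum (I : finType) (P : pred I) (p : I -> R) :
  (forall i, 0 <= p i) ->
  ent_fun (\sum_(i | P i) p i) <= \sum_(i | P i) ent_fun (p i).
Proof.
move=> p0; suff [//] : ent_fun (\sum_(i | P i) p i) <=
  \sum_(i | P i) ent_fun (p i) /\ 0 <= \sum_(i | P i) p i.
apply: (big_rec2 (fun a b => ent_fun a <= b /\ 0 <= a)) => [|i b a _ [ab a0]].
  by rewrite ent_fun0.
split; last exact: addr_ge0.
by apply: (le_trans (ent_funD (p0 i) a0)); rewrite lerD2l.
Qed.

(** Gibbs' inequality for one cell, from [ln u <= u - 1] at [u = q * r / p]. Here [p] is meant as a
    joint probability and [q], [r] as its marginals; the term [q * r - p] cancels on summing over
    all cells. *)
Lemma ent_fun_gibbs p q r : 0 <= p -> p <= q -> p <= r ->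
  ent_fun p <= (q * r - p) - p * ln q - p * ln r.
Proof.
rewrite le0r => /orP[/eqP-> q0 r0|p0 pq pr].
  by rewrite ent_fun0 !mul0r !subr0 mulr_ge0.
have q0 := lt_le_trans p0 pq; have r0 := lt_le_trans p0 pr.
have qr0 : 0 < q * r by rewrite mulr_gt0.
have : p * ln (q * r / p) <= p * (q * r / p - 1).
  by rewrite ler_pM2l// ln_le_subr1// divr_gt0.
rewrite ln_div ?posrE// lnM ?posrE// ent_funE.
have -> : p * (q * r / p - 1) = q * r - p by field; rewrite gt_eqF.
by lra.
Qed.

End ent_fun_theory.

(** * Entropy of finite-valued random variables *)

Section finite_entropy.
Context {d : measure_display} {T : measurableType d} {R : realType}.
Variable mu : probability T R.

Definition fin_measurable (I : finType) (X : T -> I) :=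
  forall i, measurable (X @^-1` [set i]).

Definition law (I : finType) (X : T -> I) (i : I) : R :=
  fine (mu (X @^-1` [set i])).

Definition entropy (I : finType) (X : T -> I) : R :=
  \sum_i ent_fun (law X i).

Lemma preimage_bigcup_set1 (I : finType) (X : T -> I) (A : set I) :
  X @^-1` A = \bigcup_(i in A) X @^-1` [set i].
Proof. by apply/seteqP; split=> x /= => [Ax|[i Ai ->//]]; exists (X x). Qed.

Lemma fin_measurable_preimage {I : finType} {X : T -> I} (A : set I) :
  fin_measurable X -> measurable (X @^-1` A).
Proof.
move=> mX; rewrite preimage_bigcup_set1; apply: fin_bigcup_measurable => //.
Qed.

Lemma fine_measure_preimage {I : finType} {X : T -> I} (P : pred I) :
  fin_measurable X -> fine (mu (X @^-1` [set` P])) = \sum_(i | P i) law X i.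
Proof.
move=> mX; rewrite preimage_bigcup_set1 measure_fin_bigcup//; last first.
  by move=> i j _ _ [x [/= <- <-]].
rewrite -(bigfs _ (index_enum_uniq I)) => [|i _]; last first.
  by rewrite mem_index_enum.
rewrite /law -sum_fine//= => i _; exact: fin_num_measure.
Qed.

Lemma fin_measurable_pair {I J : finType} {X : T -> I} {Y : T -> J} :
  fin_measurable X -> fin_measurable Y -> fin_measurable (fun x => (X x, Y x)).
Proof.
move=> mX mY [i j].
have -> : (fun x => (X x, Y x)) @^-1` [set (i, j)] =
    X @^-1` [set i] `&` Y @^-1` [set j].
  by apply/seteqP; split=> x /= => [[-> ->]//|[-> ->]].
exact: measurableI.
Qed.

Lemma law_ge0 (I : finType) (X : T -> I) i : 0 <= law X i.
Proof. by rewrite fine_ge0. Qed.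

Lemma law_comp {I J : finType} (g : I -> J) {X : T -> I} j :
  fin_measurable X -> law (g \o X) j = \sum_(i | g i == j) law X i.
Proof.
move=> mX; rewrite -fine_measure_preimage// /law; congr (fine (mu _)).
by apply/seteqP; split=> x /= /eqP.
Qed.

Lemma sum_law {I : finType} {X : T -> I} :
  fin_measurable X -> \sum_i law X i = 1.
Proof.
move=> mX; rewrite -fine_measure_preimage// (_ : _ @^-1` _ = setT).
  by rewrite probability_setT.
by apply/seteqP; split.
Qed.

(** Applying [g] merges the values in each fibre, and [ent_fun] is subadditive. *)
Lemma entropy_comp {I J : finType} (g : I -> J) {X : T -> I} :
  fin_measurable X -> entropy (g \o X) <= entropy X.
Proof.
move=> mX; rewrite /entropy [leRHS](partition_big g predT)//=.
by apply: ler_sum => j _; rewrite law_comp//; apply: ent_fun_sum => i; exact: law_ge0.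
Qed.

Lemma entropy_pair {I J : finType} {X : T -> I} {Y : T -> J} :
  fin_measurable X -> fin_measurable Y ->
  entropy (fun x => (X x, Y x)) <= entropy X + entropy Y.
Proof.
move=> mX mY; set Z := fun x => _; have mZ : fin_measurable Z by exact: fin_measurable_pair.
have lX i : law X i = \sum_j law Z (i, j).
  rewrite (_ : X = fst \o Z)// law_comp//.
  rewrite (reindex_onto (fun j => (i, j)) snd) => [|[a b]/= /eqP ->//].
  by apply: eq_bigl => j /=; rewrite !eqxx.
have lY j : law Y j = \sum_i law Z (i, j).
  rewrite (_ : Y = snd \o Z)// law_comp//.
  rewrite (reindex_onto (fun i => (i, j)) fst) => [|[a b]/= /eqP ->//].
  by apply: eq_bigl => i /=; rewrite !eqxx.
have ZX i j : law Z (i, j) <= law X i.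
  by rewrite lX (bigD1 j)//= lerDl sumr_ge0// => *; exact: law_ge0.
have ZY i j : law Z (i, j) <= law Y j.
  by rewrite lY (bigD1 i)//= lerDl sumr_ge0// => *; exact: law_ge0.
have HX : entropy X = \sum_i \sum_j - (law Z (i, j) * ln (law X i)).
  by apply: eq_bigr => i _; rewrite ent_funE sumrN -mulr_suml -lX.
have HY : entropy Y = \sum_i \sum_j - (law Z (i, j) * ln (law Y j)).
  rewrite exchange_big /=.
  by apply: eq_bigr => j _; rewrite ent_funE sumrN -mulr_suml -lY.
(* The remainders of [ent_fun_gibbs] cancel: the product of the marginals and the joint law have the
   same row sums. *)
have S0 : \sum_i \sum_j (law X i * law Y j - law Z (i, j)) = 0.
  under eq_bigr do rewrite sumrB -mulr_sumr (sum_law mY) mulr1 -lX subrr.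
  by rewrite big1.
rewrite -[leRHS]add0r -S0 HX HY -!big_split/= /entropy.
rewrite (_ : \sum_i ent_fun (law Z i) = \sum_i \sum_j ent_fun (law Z (i, j))).
  apply: ler_sum => i _; rewrite -!big_split/=; apply: ler_sum => j _.
  by rewrite addrA; apply: ent_fun_gibbs => //; exact: law_ge0.
by rewrite pair_bigA/=; apply: eq_bigr => -[].
Qed.

Lemma entropy_cst {I : finType} (X : T -> I) (i0 : I) :
  (forall x, X x = i0) -> entropy X = 0.
Proof.
move=> Xi; rewrite /entropy big1// => i _; rewrite /law.
have [<-|ne] := eqVneq i0 i.
  rewrite (_ : _ @^-1` _ = setT) ?probability_setT ?ent_fun1//.
  by apply/seteqP; split=> // x _ /=; exact: Xi.
rewrite (_ : _ @^-1` _ = set0) ?measure0 ?ent_fun0//.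
by apply/seteqP; split=> x //=; rewrite Xi; move/eqP: ne.
Qed.

Lemma fin_measurable_ffun {I : finType} {X : nat -> T -> I} n :
  (forall i, fin_measurable (X i)) ->
  fin_measurable (fun x => [ffun i : 'I_n => X i x]).
Proof.
move=> mX w; rewrite (_ : _ @^-1` _ =
  \bigcap_(i in [set: 'I_n]) X i @^-1` [set w i]).
  by apply: fin_bigcap_measurable => // i _; exact: mX.
apply/seteqP; split=> x /= => [<- i _ /=|h]; first by rewrite ffunE.
by apply/ffunP => i; rewrite ffunE h.
Qed.

Lemma entropy_ffun {I : finType} {X : nat -> T -> I} n :
  (forall i, fin_measurable (X i)) ->
  entropy (fun x => [ffun i : 'I_n => X i x]) <= \sum_(i < n) entropy (X i).
Proof.
move=> mX; elim: n => [|n IH].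
  rewrite big_ord0 (entropy_cst (i0 := [ffun i : 'I_0 => X i point]))//.
  by move=> x; apply/ffunP; case.
rewrite big_ord_recr/=; apply: le_trans (lerD IH (lexx _)).
apply: le_trans (entropy_pair (fin_measurable_ffun mX) (mX n)).
(* Appends a last letter to a word of length [n]; [unlift ord_max] is [None] exactly at the last
   index. *)
pose g (z : {ffun 'I_n -> I} * I) :=
  [ffun i : 'I_n.+1 => oapp z.1 z.2 (unlift ord_max i)].
rewrite (_ : (fun x => [ffun i : 'I_n.+1 => X i x]) =
  g \o (fun x => ([ffun i : 'I_n => X i x], X n x))).
  apply: entropy_comp.
  by apply: fin_measurable_pair => //; exact: fin_measurable_ffun.
apply/funext => x; apply/ffunP => i; rewrite !ffunE.
by case: unliftP => [j|] ->; rewrite ?lift_max/= ?ffunE.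
Qed.

(** [None] has mass at least [1 - e] and contributes at most [e]; any other value has mass at most
    [e] and contributes at most [2 * Num.sqrt e]. *)
Lemma entropy_option {I : finType} {X : T -> option I} (e : R) :
  fin_measurable X -> (mu (X @^-1` [set~ None]) <= e%:E)%E ->
  entropy X <= e + #|I|%:R * (2 * Num.sqrt e).
Proof.
move=> mX Xe.
have lawP : \sum_i law X (Some i) <= e.
  rewrite -lee_fin; apply: le_trans Xe.
  rewrite -[leRHS]fineK ?lee_fin ?fin_num_measure//; last first.
    exact: fin_measurable_preimage.
  have -> : [set~ None] = [set` (fun o : option I => o != None)].
    by apply/seteqP; split=> o /= /eqP.
  by rewrite fine_measure_preimage// [leRHS]big_mkcond big_option/= add0r.
have law1 := sum_law mX; rewrite big_option/= in law1.
rewrite /entropy big_option/= lerD//.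
  apply: le_trans (ent_fun_le_1B (law_ge0 _ _)) _; lra.
rewrite -sum1_card natr_sum mulr_suml; apply: ler_sum => i _; rewrite mul1r.
apply: le_trans (ent_fun_le_sqrt (law_ge0 _ _)) _.
rewrite ler_pM2l// ler_wsqrtr//; apply: le_trans lawP.
by rewrite (bigD1 i)//= lerDl sumr_ge0// => *; exact: law_ge0.
Qed.

End finite_entropy.

(** * Lusin's theorem for Borel sets *)

Lemma measureU_le_half {d : measure_display} {T : measurableType d} {R : realType}
    (mu : {measure set T -> \bar R}) (A B : set T) (e : R) :
  measurable A -> measurable B -> (mu A <= (e / 2)%:E)%E ->
  (mu B <= (e / 2)%:E)%E -> (mu (A `|` B) <= e%:E)%E.
Proof.
move=> mA mB Ae Be; apply: le_trans (measureU2 _ mA mB) _.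
by rewrite [e]splitr EFinD leeD.
Qed.

Section lusin.
Context {R : realType} {X : pointedMetricType R}.
Local Notation BX := (borel_of X).
Variable mu : probability BX R.

Lemma open_measurable_borel (A : set X) : open A -> measurable (A : set BX).
Proof. exact: sub_sigma_algebra. Qed.

Lemma exists_measure_le (F : nat -> set BX) (e : R) :
  (forall n, measurable (F n)) -> nonincreasing_seq F ->
  \bigcap_n F n = set0 -> 0 < e -> exists n, (mu (F n) <= e%:E)%E.
Proof.
move=> mF dF F0 e0.
have : mu (F n) @[n --> \oo] --> mu (\bigcap_n F n).
  apply: nonincreasing_cvg_mu => //.
  - by rewrite ltey_eq fin_num_measure.
  - exact: bigcapT_measurable.
rewrite F0 measure0 => /fine_cvgP[_] /cvgr0Pnorm_le /(_ _ e0)[n _ /(_ n (leqnn n))] /=.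
move=> h; exists n; rewrite -[leLHS]fineK ?fin_num_measure// lee_fin.
exact: le_trans (ler_norm _) h.
Qed.

(* Lusin's theorem for the indicator of [A]: off a set of small measure, it
   is uniformly locally constant. *)
Definition almost_unif_clopen (A : set X) := forall e : R, 0 < e ->
  exists2 B : set BX, measurable B /\ (mu B <= e%:E)%E &
  exists2 r : R, 0 < r &
    forall x y, ~ B x -> ~ B y -> mdist x y <= r -> A x -> A y.

(** The same [B] and [r] serve: take the contrapositive with [x] and [y] exchanged. *)
Lemma almost_unif_clopenC (A : set X) :
  almost_unif_clopen A -> almost_unif_clopen (~` A).
Proof.
move=> aA e /aA[B mB [r r0 h]]; exists B => //; exists r => // x y Bx By xy nAx Ay.
by apply: nAx; apply: h Ay => //; rewrite metric_sym.
Qed.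

Lemma almost_unif_clopenU (A A' : set X) :
  almost_unif_clopen A -> almost_unif_clopen A' ->
  almost_unif_clopen (A `|` A').
Proof.
move=> aA aA' e e0.
have e2 : 0 < e / 2 by rewrite divr_gt0.
have [B [mB Be] [r r0 h]] := aA _ e2.
have [B' [mB' Be'] [r' r0' h']] := aA' _ e2.
exists (B `|` B').
  split; first exact: measurableU.
  exact: measureU_le_half.
exists (Num.min r r'); first by rewrite lt_min r0.
move=> x y /not_orP[Bx Bx'] /not_orP[By By'].
rewrite le_min => /andP[xy xy'] [Ax|Ax].
  by left; apply: h Ax.
by right; apply: h' Ax.
Qed.

(** A finite subunion [U n] misses only a set of small measure, which joins the exceptional set of
    [U n]. *)
Lemma almost_unif_clopen_bigcup (A : nat -> set X) :
  (forall n, measurable (A n : set BX)) -> (forall n, almost_unif_clopen (A n)) ->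
  almost_unif_clopen (\bigcup_n A n).
Proof.
move=> mA aA e e0.
have e2 : 0 < e / 2 by rewrite divr_gt0.
pose U n : set BX := \big[setU/set0]_(i < n) A i.
have mU n : measurable (U n) by exact: bigsetU_measurable.
have aU n : almost_unif_clopen (U n).
  elim: n => [|n IH]; rewrite /U.
    rewrite big_ord0 => e' e'0; exists set0; last by exists 1.
    by split=> //; rewrite measure0 lee_fin ltW.
  by rewrite big_ord_recr/=; exact: almost_unif_clopenU.
have [n Fn] : exists n, (mu ((\bigcup_n A n : set BX) `\` U n) <= (e / 2)%:E)%E.
  apply: exists_measure_le => //.
  - move=> n; apply: measurableD => //; exact: bigcupT_measurable.
  - move=> m n mn; apply/subsetPset; apply: setDS.
    exact: subset_bigsetU.
  - apply/seteqP; split=> // x h; have [[n _ Anx] _] := h 0%N I.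
    have [_] := h n.+1 I; apply; rewrite /U.
    by rewrite -bigcup_mkord; exists n => /=.
have [B [mB Be] [r r0 h]] := aU n _ e2.
have mF : measurable ((\bigcup_n A n : set BX) `\` U n).
  apply: measurableD => //; exact: bigcupT_measurable.
exists (((\bigcup_n A n) `\` U n) `|` B).
  split; first exact: measurableU.
  exact: measureU_le_half.
exists r => // x y /not_orP[Fx Bx] /not_orP[Fy By] xy Ax.
have Ux : U n x by apply: contrapT => Ux; apply: Fx.
by have := h _ _ Bx By xy Ux; rewrite /U -bigcup_mkord => -[i _ ?]; exists i.
Qed.

(** The exceptional set is an inner collar: the points of [A] very close to the complement. Collars
    decrease to the empty set because [A] is open. *)
Lemma almost_unif_clopen_open (A : set X) : open A -> almost_unif_clopen A.
Proof.
move=> oA e e0.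
pose F n : set BX := A `&` \bigcup_(y in ~` A) [set x | mdist y x < n.+1%:R^-1].
have mF n : measurable (F n).
  apply: measurableI; first exact: open_measurable_borel.
  apply: open_measurable_borel; apply: bigcup_open => y _.
  rewrite openE => x /= yx; apply/nbhs_ballP.
  exists (n.+1%:R^-1 - mdist y x) => /=; first by rewrite subr_gt0.
  rewrite ballEmdist => z /= xz.
  by rewrite (le_lt_trans (metric_triangle _ x _))// -ltrBrDl.
have [n Fn] : exists n, (mu (F n) <= e%:E)%E.
  apply: exists_measure_le => //.
    move=> m n mn; apply/subsetPset => x [Ax [y Ay xy]]; split => //; exists y => //.
    by rewrite /= (lt_le_trans xy)// lef_pV2 ?posrE// ler_nat.
  apply/seteqP; split=> // x h; have [Ax _] := h 0%N I.
  have /nbhs_ballP[r /= r0] := open_nbhs_nbhs (conj oA Ax); rewrite ballEmdist => rA.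
  have [_ [y nAy /=]] := h (Num.truncn r^-1) I; rewrite metric_sym => xy.
  apply/nAy/rA => /=; apply: lt_trans xy _.
  by rewrite invf_plt ?posrE// truncnS_gt.
(* The collar has width [n.+1%:R^-1] with a strict inequality, whereas closeness is non-strict;
   hence the smaller radius [n.+2%:R^-1]. *)
exists (F n) => //; exists (n.+2%:R^-1) => // x y Fx Fy xy Ax.
apply: contrapT => nAy; apply: Fx; split => //; exists y => //=.
rewrite metric_sym (le_lt_trans xy)// ltf_pV2 ?posrE// ltr_nat//.
Qed.

(** The Borel sets with this property form a sigma-algebra containing the open sets. Measurability
    is carried along for the step of countable unions. *)
Lemma measurable_almost_unif_clopen (A : set BX) :
  measurable A -> almost_unif_clopen A.
Proof.
suff h : <<s @open X >> `<=` [set A | measurable (A : set BX) /\ almost_unif_clopen A].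
  by move=> /h[].
apply: smallest_sub => [|B oB]; last first.
  by split; [exact: open_measurable_borel|exact: almost_unif_clopen_open].
split.
- by split => // e e0; exists set0; [rewrite measure0 lee_fin ltW|exists 1].
- move=> B [mB aB]; rewrite setTD; split; first exact: measurableC.
  exact: almost_unif_clopenC.
- move=> B h; split; first by apply: bigcupT_measurable => n; have [] := h n.
  by apply: almost_unif_clopen_bigcup => n; have [] := h n.
Qed.

Lemma almost_unif_clopen_family (I : finType) (P : I -> set BX) (e : R) :
  (forall i, measurable (P i)) -> 0 < e ->
  exists2 B : set BX, measurable B /\ (mu B <= e%:E)%E &
  exists2 r : R, 0 < r &
    forall x y, ~ B x -> ~ B y -> mdist x y <= r -> forall i, P i x -> P i y.
Proof.
move=> mP e0.
suff [B mB [r r0 h]] : exists2 B : set BX, measurable B /\ (mu B <= e%:E)%E &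
  exists2 r : R, 0 < r & forall x y, ~ B x -> ~ B y -> mdist x y <= r ->
    forall i, i \in enum I -> P i x -> P i y.
  exists B => //; exists r => // x y Bx By xy i; apply: (h _ _ Bx By xy).
  by rewrite mem_enum.
elim: (enum I) e e0 => [|i s IH] e e0.
  exists set0; first by split => //; rewrite measure0 lee_fin ltW.
  by exists 1.
have e2 : 0 < e / 2 by rewrite divr_gt0.
have [B [mB Be] [r r0 h]] := measurable_almost_unif_clopen (mP i) e2.
have [B' [mB' Be'] [r' r0' h']] := IH _ e2.
exists (B `|` B').
  split; first exact: measurableU.
  exact: measureU_le_half.
exists (Num.min r r'); first by rewrite lt_min r0.
move=> x y /not_orP[Bx Bx'] /not_orP[By By'].
rewrite le_min => /andP[xy xy'] j; rewrite inE => /orP[/eqP->|js].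
  exact: h.
exact: h'.
Qed.

End lusin.

(** * Invariance, ergodicity and dynamical balls *)

Section dynamics.
Context {R : realType} {X : pointedMetricType R}.
Local Notation BX := (borel_of X).
Variables (f : X -> X) (mu : probability BX R).
Hypothesis cf : continuous f.

Lemma continuous_iter n : continuous (iter n f).
Proof.
elim: n => [|n IH] x; first exact: cvg_id.
by apply: (@continuous_comp _ _ _ (iter n f) f); [exact: IH|exact: cf].
Qed.

Lemma measurable_preimage_continuous (g : X -> X) (A : set BX) :
  continuous g -> measurable A -> measurable (g @^-1` A : set BX).
Proof.
move=> cg; suff h : <<s @open X >> `<=` [set A | measurable (g @^-1` A : set BX)].
  exact: h.
apply: smallest_sub => [|B oB]; last first.
  by apply: open_measurable_borel; apply: open_comp => // x _; exact: cg.
split.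
- by rewrite /= preimage_set0.
- by move=> B mB; rewrite setTD /= preimage_setC; exact: measurableC.
- by move=> B mB; rewrite /= preimage_bigcup; exact: bigcupT_measurable.
Qed.

Lemma measurable_preimage_iter n (A : set BX) :
  measurable A -> measurable (iter n f @^-1` A : set BX).
Proof. exact: measurable_preimage_continuous (@continuous_iter n). Qed.

Lemma measurable_dyn_ball (r : R) (x : X) : measurable (dyn_ball f r x).
Proof.
have -> : dyn_ball f r x =
    \bigcap_n (iter n f @^-1` [set y | mdist y (iter n f x) <= r]).
  by apply/seteqP; split=> y h n => [_|]; exact: h.
apply: bigcapT_measurable => n; apply: measurable_preimage_iter.
rewrite -[X in measurable X]setCK; apply: measurableC; apply: open_measurable_borel.
rewrite openE => y /= /negP; rewrite -ltNge => ry; apply/nbhs_ballP.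
exists (mdist y (iter n f x) - r) => /=; first by rewrite subr_gt0.
rewrite ballEmdist => z /= yz; apply/negP; rewrite -ltNge.
by have := metric_triangle y z (iter n f x); lra.
Qed.

Hypothesis imu : invariant_measure f mu.

Lemma invariant_measure_iter n (A : set BX) :
  measurable A -> mu (iter n f @^-1` A) = mu A.
Proof.
move=> mA; elim: n => // n IH; rewrite -IH.
rewrite -[RHS]imu; last exact: measurable_preimage_iter.
by congr (mu _); apply/seteqP; split => x /=; rewrite -iterSr.
Qed.

Lemma iter_dyn_ball n (r : R) (x y : X) :
  dyn_ball f r x y -> dyn_ball f r (iter n f x) (iter n f y).
Proof. by move=> h i; rewrite -!iterD. Qed.

Hypothesis emu : ergodic_measure f mu.

(* A set [S] with [S `<=` f^-1 S] has the measure of the strictly invariant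
   set of the points whose orbit meets [S]. *)
Lemma ergodic_sub_preimage (S : set BX) : measurable S ->
  S `<=` f @^-1` S -> mu S != 0%E -> mu S = 1%E.
Proof.
move=> mS Sf S0; pose W := \bigcup_n (iter n f @^-1` S).
have ndW : nondecreasing_seq (fun n => iter n f @^-1` S : set BX).
  apply/nondecreasing_seqP => n; apply/subsetPset => x /= /Sf.
  by rewrite /= -iterS.
have mW : measurable (W : set BX).
  by apply: bigcupT_measurable => n; exact: measurable_preimage_iter.
have WS : mu W = mu S.
  have : mu (iter n f @^-1` S) @[n --> \oo] --> mu W.
    apply: nondecreasing_cvg_mu => // n; exact: measurable_preimage_iter.
  rewrite (_ : (fun n => _) = fun=> mu S).
    by move/cvg_lim => <- //; rewrite lim_cst.
  by apply/funext => n; exact: invariant_measure_iter.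
rewrite -WS; have [] // := emu mW.
  apply/seteqP; split => x [n _ /=] h.
    by exists n.+1 => //=; rewrite -iterS iterSr.
  by exists n => //=; rewrite -iterSr /=; exact: Sf.
by rewrite WS => S0'; rewrite S0' eqxx in S0.
Qed.

(** [f] maps each ball of the orbit into the next, so their union [S] has full measure; continuity
    from above then leaves finitely many balls. *)
Lemma orbit_dyn_ball_cover (r : R) (x : X) (e : R) :
  mu (dyn_ball f r x) != 0%E -> 0 < e ->
  exists M, (mu (~` \bigcup_(m < M) dyn_ball f r (iter m f x)) <= e%:E)%E.
Proof.
move=> x0 e0; pose S : set BX := \bigcup_m dyn_ball f r (iter m f x).
have mS : measurable S.
  by apply: bigcupT_measurable => m; exact: measurable_dyn_ball.
have S1 : mu S = 1%E.
  apply: ergodic_sub_preimage => //.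
    move=> y [m _ /= ym]; exists m.+1 => //.
    by have := iter_dyn_ball 1 ym; rewrite -iterD.
  rewrite gt_eqF//; have : (0 < mu (dyn_ball f r x))%E by rewrite lt0e x0/=.
  move/lt_le_trans; apply; apply: le_measure; rewrite ?inE//.
    exact: measurable_dyn_ball.
  by move=> y; exists 0%N.
pose U M : set BX := \bigcup_(m < M) dyn_ball f r (iter m f x).
have mU M : measurable (U M).
  apply: fin_bigcup_measurable => // m _; exact: measurable_dyn_ball.
have [M SU] : exists M, (mu (S `\` U M) <= e%:E)%E.
  apply: exists_measure_le => // [M||].
  - exact: measurableD.
  - move=> m n mn; apply/subsetPset; apply: setDS => y [i /= im h].
    by exists i => //=; exact: leq_trans mn.
  - apply/seteqP; split=> // y h; have [[m _ ym] _] := h 0%N I.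
    by have [_] := h m.+1 I; apply; exists m => /=.
exists M; apply: le_trans SU.
rewrite -[leRHS]add0e; have <- : mu (~` S) = 0%E.
  by rewrite probability_setC// S1 subee.
apply: le_trans (measureU2 _ _ _).
- apply: le_measure; rewrite ?inE.
  + by apply: measurableC; exact: mU.
  + by apply: measurableU; [exact: measurableC|exact: measurableD].
  + by move=> y nU; have [Sy|Sy] := pselect (S y); [right|left].
- exact: measurableC.
- exact: measurableD.
Qed.

(** * Entropy of itineraries *)

Section join.
Variables (k : nat) (P : 'I_k -> set BX).
Hypothesis pP : measurable_partition P.

Lemma measurable_partition_symbol : exists s : X -> 'I_k,
  forall x i, P i x <-> s x = i.
Proof.
have [mP dP cP] := pP.
have /choice[s Ps] : forall x : X, exists i, P i x.
  by move=> x; have : [set: BX] x by []; rewrite -cP => -[i _ Pi]; exists i.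
exists s => x i; split=> [Pi|<-//]; apply: contrapT => /eqP si.
by have : (P (s x) `&` P i) x by []; rewrite dP.
Qed.

(** A join cell is the fibre of the itinerary map over its word. *)
Lemma join_entropyE (s : X -> 'I_k) (n : nat) :
  (forall x i, P i x <-> s x = i) ->
  join_entropy f mu n P =
  entropy mu (fun x : BX => [ffun i : 'I_n => s (iter i f x)]).
Proof.
move=> sP; apply: eq_bigr => w _; congr (ent_fun (fine (mu _))).
apply/seteqP; split=> x /= h.
  by apply/ffunP => i; rewrite ffunE; exact/sP/h.
by move=> i; apply/sP; rewrite -h ffunE.
Qed.

(* Up to a set of measure [e/2] every orbit is shadowed by one of finitely
   many reference orbits, and off a set of measure [e/2] shadowing within [r]
   preserves the partition symbol: an itinerary is thus recovered from the
   index of the reference orbit and, at each time, the symbol if one of these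
   exceptional events occurs. *)
Lemma join_entropy_le (e : R) :
  (forall r, 0 < r -> exists x, mu (dyn_ball f r x) != 0%E) -> 0 < e ->
  exists C : R, forall n,
    join_entropy f mu n P <= C + n%:R * (e + k%:R * (2 * Num.sqrt e)).
Proof.
move=> nexp e0; have [mP _ _] := pP.
have [s sP] := measurable_partition_symbol.
have e2 : 0 < e / 2 by rewrite divr_gt0.
have [B [mB Be] [r r0 Br]] := almost_unif_clopen_family mu mP e2.
(* Half of [r], since two points close to the same reference point are compared by the triangle
   inequality. *)
have [x x0] := nexp (r / 2) (divr_gt0 r0 (ltr0Sn _ 1)).
have [M De] := orbit_dyn_ball_cover x0 e2.
pose U m := dyn_ball f (r / 2) (iter m f x).
set D : set BX := ~` _ in De.
have mD : measurable D.
  apply: measurableC; apply: fin_bigcup_measurable => // m _.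
  exact: measurable_dyn_ball.
(* The exceptional event at time [i]; by invariance its bound [e] does not depend on [i]. *)
pose E i : set BX := D `|` iter i f @^-1` B.
have mE i : measurable (E i).
  by apply: measurableU => //; exact: measurable_preimage_iter.
have Ee i : (mu (E i) <= e%:E)%E.
  have Bi : (mu (iter i f @^-1` B) <= (e / 2)%:E)%E.
    by rewrite invariant_measure_iter.
  by apply: measureU_le_half => //; exact: measurable_preimage_iter.
pose Y i (y : BX) := if `[< E i y >] then Some (s (iter i f y)) else None.
have YN i : Y i @^-1` [set~ None] = E i.
  apply/seteqP; split=> y; rewrite /= /Y; first by case: asboolP.
  by move=> Ey; case: asboolP.
have mY i : fin_measurable (Y i).
  case=> [a|]; last first.
    rewrite -[X in measurable X]setCK preimage_setC YN; exact: measurableC.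
  rewrite (_ : _ @^-1` _ = E i `&` iter i f @^-1` P a).
    by apply: measurableI => //; exact: measurable_preimage_iter.
  apply/seteqP; split=> y; rewrite /= /Y; first by case: asboolP => // ? [/sP].
  by move=> [Ey /sP Pa]; case: asboolP => //; rewrite Pa.
pose J m (y : BX) := `[< U m y >].
have mJ m : fin_measurable (J m).
  have mUm : measurable (U m) by exact: measurable_dyn_ball.
  case.
    rewrite (_ : _ @^-1` _ = U m)//.
    by apply/seteqP; split=> y /=; [move/asboolP|move=> ?; exact/asboolP].
  rewrite (_ : _ @^-1` _ = ~` U m); first exact: measurableC.
  by apply/seteqP; split=> y /=; [move/asboolPn|move=> ?; exact/asboolPn].
(* The constant is the entropy of the shadowing indicators; [M] was fixed before [n]. *)
exists (entropy mu (fun y => [ffun m : 'I_M => J m y])) => n.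
(* The reference point may itself lie in [B], so the symbol is read at some point outside [B] near
   it. Whenever [a m i] matters, [iter i f y] is such a point. *)
pose a (m i : nat) := s (xget point
  [set z | ~ B z /\ mdist z (iter i f (iter m f x)) <= r / 2]).
pose g (z : {ffun 'I_M -> bool} * {ffun 'I_n -> option 'I_k}) : {ffun 'I_n -> 'I_k} :=
  [ffun i : 'I_n => if z.2 i is Some b then b else
    if [pick m | z.1 m] is Some m then a m i else s point].
rewrite (join_entropyE _ sP).
have -> : (fun y : BX => [ffun i : 'I_n => s (iter i f y)]) = g \o
    (fun y => ([ffun m : 'I_M => J m y], [ffun i : 'I_n => Y i y])).
  apply/funext => y; apply/ffunP => i; rewrite !ffunE /= ?ffunE {1}/Y.
  case: asboolP => // /not_orP[Dy By]; case: pickP => [m|nJ].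
    rewrite ffunE => /asboolP Um; apply/esym/sP.
    case: xgetP => [z _ [Bz zm]|/(_ (iter i f y))]; last first.
      by case; split => //; exact: Um.
    (* Both points avoid [B] and lie within [r / 2] of the reference point, so they share their
       symbol. *)
    apply: (Br (iter i f y) z By Bz) => /=; last exact/sP.
    have := metric_triangle (iter i f y) (iter i f (iter m f x)) z.
    by have := Um i; rewrite (metric_sym z) in zm; lra.
  case: Dy => -[m /= mM Um]; have := nJ (Ordinal mM); rewrite ffunE /=.
  by move=> /asboolP; apply.
have mJJ := fin_measurable_ffun (n := M) mJ.
have mYY := fin_measurable_ffun (n := n) mY.
apply: le_trans (entropy_comp mu _ (fin_measurable_pair mJJ mYY)) _.
apply: le_trans (entropy_pair mu mJJ mYY) _; rewrite lerD2l.
apply: le_trans (entropy_ffun mu n mY) _.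
rewrite -[in n%:R](card_ord n) -sum1_card natr_sum mulr_suml.
apply: ler_sum => i _; rewrite mul1r -[k in k%:R]card_ord.
by apply: entropy_option => //; rewrite YN.
Qed.

(** After division by [n] the constant [C] of [join_entropy_le] disappears in the limit, and the
    remaining rate is arbitrarily small. *)
Lemma partition_entropy_le0 :
  (forall r, 0 < r -> exists x, mu (dyn_ball f r x) != 0%E) ->
  partition_entropy f mu P <= 0.
Proof.
move=> nexp; rewrite /partition_entropy; set u : nat -> R^o := fun n : nat => _.
(* the junk value of the limit of a divergent sequence is [point = 0] *)
have [cu|/dvgP -> //] := pselect (cvgn u).
apply/ler_addgt0Pl => t t0; rewrite addr0.
pose c : R := 1 + k%:R * 2; have c0 : 0 < c by rewrite ltr_pwDl// mulr_ge0.
(* [join_entropy_le] is used at [q ^+ 2], whose square root is [q]; as [q <= 1], the rate is at most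
   [c * q <= t / 2]. The other [t / 2] absorbs [C / n]. *)
pose q := Num.min 1 (t / 2 / c).
have q0 : 0 < q by rewrite lt_min ltr01 !divr_gt0.
have [C HC] := join_entropy_le nexp (exprn_gt0 2 q0).
have qt : q ^+ 2 + k%:R * (2 * Num.sqrt (q ^+ 2)) <= t / 2.
  rewrite sqrtr_sqr gtr0_norm//; apply: (@le_trans _ _ (c * q)).
    have -> : c * q = q + k%:R * (2 * q) by rewrite /c; ring.
    rewrite lerD2r expr2 ler_piMl//; first exact: ltW.
    by rewrite /q ge_min lexx.
  by rewrite mulrC -ler_pdivlMr// /q ge_min lexx orbT.
apply: limr_le => //; near=> n.
have n0 : (0 : R) < n%:R by rewrite ltr0n; near: n; exact: nbhs_infty_gt.
rewrite /u ler_pdivrMr//; apply: le_trans (HC n) _.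
have -> : t * n%:R = t / 2 * n%:R + t / 2 * n%:R by rewrite -mulrDl -splitr.
rewrite lerD//.
  rewrite mulrC -ler_pdivrMr ?divr_gt0//.
  by near: n; exact: nbhs_infty_ger.
by rewrite mulrC ler_wpM2r// ltW.
Unshelve. all: by end_near.
Qed.

End join.
End dynamics.

Theorem theorem4p1 (R : realType) (X : pointedMetricType R) (f : X -> X)
  (mu : probability (borel_of X) R) :
  compact [set: X] ->
  continuous f ->
  invariant_measure f mu ->
  ergodic_measure f mu ->
  (0 < metric_entropy f mu)%E ->
  expansive_measure f mu.
Proof.
(* A positive supremum yields a single partition of positive entropy, to be contradicted. *)
move=> _ cf imu emu /ereal_sup_gt[_ [k [P [pP ->]]]]; rewrite lte_fin => P0.
apply: contrapT => nexp.
suff : partition_entropy f mu P <= 0 by rewrite leNgt P0.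
apply: partition_entropy_le0 => // r r0; apply: contrapT => h.
apply: nexp; exists r => // x; apply: contrapT => /eqP x0; apply: h.
by exists x.
Qed.
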